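(* Let $s > 1$ and $t > 1$ be integers. (1) Let $\mathcal{X} = (\mathcal{P},\mathcal{B}, I)$ be a $GQ(s,t)$ that possesses an ovoid $O$. Let $\mathcal{P}' = O$ and define a family of blocks $\mathcal{B}'$ as follows: for each $x \in \mathcal{P} - O$, $b_x = \{p \in O \mid x \sim p \}$ is a block in $\mathcal{B}'$ (so $\mathcal{B}'$ has one member for each $x \in \mathcal{P}-O$). Given a point $p \in O$, let $l_1, \dots , l_{t+1}$ be the lines of $\mathcal{B}$ incident with $p$; and for each such $l_i$, let $S_{p,i} = \{ b_x \mid x \in \mathcal{P} - O \text{ and } x \mathrel{I} l_i \}$. Let $X_p = \{ S_{p,i} \mid 1 \leq i \leq t+1 \}$ and let $\mathcal{C} = \{ X_p \mid p \in O \}$. Then $\mathcal{Y} = (\mathcal{P}', \mathcal{B}')$ is a locally resolvable BIBD$(1+st,1+t,1+t)$ with $\mathcal{C}$ a non-triangular local resolution system. Denote $\mathcal{N}(\mathcal{X},O) = (\mathcal{Y},\mathcal{C})$. (2) Suppose $\mathcal{X} =(\mathcal{P}, \mathcal{B})$ is a locally resolvable BIBD$(1+st,1+t,1+t)$ with $\mathcal{C} = \{ X_p \mid p \in \mathcal{P} \}$ a non-triangular local resolution system. Let $O = \mathcal{P}$ and let $\mathcal{P}' = \mathcal{P} \cup \mathcal{B}$. Define a line set $\mathcal{B}'$ so that for each $p \in \mathcal{P}$ and each $S \in X_p$, $S \in \mathcal{B}'$ (these being all the lines). The incidence relation $I$ is defined as follows: for $p \in \mathcal{P}$ and $S \in \mathcal{B}'$,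 $p \mathrel{I} S$ if and only if $S \in X_p$; and for $b \in \mathcal{B}$ and $S \in \mathcal{B}'$, $b \mathrel{I} S$ if and only if $b \in S$. Then $\mathcal{Y} = (\mathcal{P}',\mathcal{B}',I)$ is a $GQ(s,t)$ with ovoid $O$. Denote $\mathcal{M}(\mathcal{X},\mathcal{C}) = (\mathcal{Y},O)$. (3) Let $\mathcal{X}$ be a $GQ(s,t)$ that possesses an ovoid $O$ and let $\mathcal{Y}$ be a locally resolvable BIBD$(1+st,1+t,1+t)$ with $\mathcal{C}$ a non-triangular local resolution system. Let $\mathcal{N}(\mathcal{X},O)$ and $\mathcal{M}(\mathcal{Y},\mathcal{C})$ be defined as in (1) and (2). Then $\mathcal{M}(\mathcal{N}(\mathcal{X},O)) = (\mathcal{X},O)$ and $\mathcal{N}(\mathcal{M}(\mathcal{Y},\mathcal{C})) = (\mathcal{Y},\mathcal{C})$.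
   Context: **Generalized quadrangles.** A finite incidence structure $(\mathcal{P},\mathcal{B},I)$ of points and lines is a generalized quadrangle $GQ(s,t)$ if: (i) each point is incident with $1+t$ lines ($t\ge 1$) and two distinct points are incident with at most one common line; (ii) each line is incident with $1+s$ points ($s\ge 1$) and two distinct lines are incident with at most one common point; (iii) if $x$ is a point and $L$ is a line not incident with $x$, there is a unique pair $(y,M)\in\mathcal{P}\times\mathcal{B}$ with $x \mathrel{I} M \mathrel{I} y \mathrel{I} L$. For points $x,y$, write $x\sim y$ (collinear) if some line is incident with both. An ovoid is a set $O$ of points such that every line is incident with exactly one point of $O$. **BIBDs.** A BIBD$(v,k,\lambda)$, with $k<v$, is a pair $(\mathcal{P},\mathcal{B})$ (points, blocks) where $\mathcal{P}$ is a set of $v$ points and $\mathcal{B}$ is a family of $k$-subsets of $\mathcal{P}$, called blocks, such that every 2-subset of $\mathcal{P}$ is contained in exactly $\lambda$ blocks. The family $\mathcal{B}$ may be a multiset containing repeated blocks; different members of the family are considered distinct even if they are equal as sets. **Local resolutions.** A BIBD with point set $\mathcal{P}$ is locally resolvable at $p\in\mathcal{P}$ if the family of blocks that contain $p$ can be partitioned into sets so that for each set $S$ in the partition, $\{b-\{p\} \mid b\in S\}$ is a partition of $\mathcal{P}-\{p\}$. A set $S$ in the partition is called a parallel class about $p$, and such a partition of the blocks containing $p$ is called a local resolution about $p$. A BIBD is locally resolvable if it is locally resolvable at each point. A local resolution system is a collection $\{X_p \mid p\in\mathcal{P}\}$ with $X_p$ a local resolution about $p$ for every $p \in \mathcal{P}$.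 **Non-triangular.** A local resolution system is non-triangular if for any three distinct blocks $b,c,d\in\mathcal{B}$: if $b$ and $c$ are in a common parallel class about $p$, and $b$ and $d$ are in a common parallel class about $q$, for some points $p\neq q$, then $c$ and $d$ are not in a common parallel class about $r$ for any point $r\in\mathcal{P}$. (Here the parallel classes about a point $p$ are the members of $X_p$.) *)

(* Defs.v *)
From HB Require Import structures.
From mathcomp Require Import all_boot.

Set Implicit Arguments.
Unset Strict Implicit.
Unset Printing Implicit Defensive.

Record incidence := Incidence {
  point : finType;
  line : finType;
  inc : point -> line -> bool }.

(* An incidence structure has points and lines by convention; without the two
   nonemptiness clauses the empty structure would be a GQ(s, t) for all s, t. *)
Definition is_GQ (s t : nat) (X : incidence) : Prop :=
  [/\ 0 < #|point X| /\ 0 < #|line X|,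
      1 <= s /\ 1 <= t,
      (forall x : point X, #|[set l | inc x l]| = 1 + t) /\
      (forall x y : point X, x != y -> #|[set l | inc x l && inc y l]| <= 1),
      (forall l : line X, #|[set x | inc x l]| = 1 + s) /\
      (forall l m : line X, l != m -> #|[set x | inc x l && inc x m]| <= 1) &
      forall (x : point X) (L : line X), ~~ inc x L ->
        exists! yM : point X * line X,
          [/\ inc x yM.2, inc yM.1 yM.2 & inc yM.1 L]].

Definition collinear (X : incidence) (x y : point X) : bool :=
  [exists l, inc x l && inc y l].

Definition is_ovoid (X : incidence) (O : {set point X}) : Prop :=
  forall l : line X, #|[set x in O | inc x l]| = 1.

(* A family of blocks is indexed by a finite type, so that repeated blocks are
   distinct members of [block Y]. *)
Record design := Design {
  dpoint : finType;
  block : finType;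
  blockset : block -> {set dpoint} }.

Definition is_BIBD (v k lambda : nat) (Y : design) : Prop :=
  [/\ k < v,
      #|dpoint Y| = v,
      forall b : block Y, #|blockset b| = k &
      forall A : {set dpoint Y}, #|A| = 2 ->
        #|[set b : block Y | A \subset blockset b]| = lambda].

(* The injectivity clause makes [b - {p} | b in S] a partition as a family: two
   equal blocks of [S], seen as distinct members, would overlap. *)
Definition is_parallel_class (Y : design) (p : dpoint Y) (S : {set block Y}) :
    Prop :=
  {in S &, injective (fun b => blockset b :\ p)} /\
  partition [set blockset b :\ p | b in S] [set~ p].

Definition is_local_resolution (Y : design) (p : dpoint Y)
    (R : {set {set block Y}}) : Prop :=
  partition R [set b | p \in blockset b] /\
  (forall S, S \in R -> is_parallel_class p S).

Definition locally_resolvable (Y : design) : Prop :=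
  forall p : dpoint Y, exists R, is_local_resolution p R.

Definition system (Y : design) : Type := dpoint Y -> {set {set block Y}}.

Definition is_local_resolution_system (Y : design) (C : system Y) : Prop :=
  forall p, is_local_resolution p (C p).

Definition in_common_class (Y : design) (C : system Y) (p : dpoint Y)
    (b c : block Y) : bool :=
  [exists S in C p, (b \in S) && (c \in S)].

Definition non_triangular (Y : design) (C : system Y) : Prop :=
  forall b c d : block Y, b != c -> b != d -> c != d ->
  forall p q : dpoint Y, p != q ->
    in_common_class C p b c -> in_common_class C q b d ->
    forall r : dpoint Y, ~~ in_common_class C r c d.

Section FromOvoid.
Variables (X : incidence) (O : {set point X}).

Definition N_design : design :=
  @Design {p : point X | p \in O} {x : point X | x \notin O}
    (fun x => [set p | collinear (val x) (val p)]).

Definition N_class (l : line X) : {set block N_design} :=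
  [set x : block N_design | inc (val x) l].

Definition N_system : system N_design :=
  fun p => [set N_class l | l : line X & inc (val p) l].

End FromOvoid.

Section FromSystem.
Variables (Y : design) (C : system Y).

Definition M_incidence : incidence :=
  @Incidence (dpoint Y + block Y)%type
    {S : {set block Y} | [exists p, S \in C p]}
    (fun u S => match u with
                | inl p => val S \in C p
                | inr b => b \in val S
                end).

Definition M_ovoid : {set point M_incidence} :=
  [set (inl p : point M_incidence) | p : dpoint Y].

End FromSystem.

Definition ovoid_iso (X X' : incidence) (O : {set point X})
    (O' : {set point X'}) (f : point X -> point X') (g : line X -> line X') :
    Prop :=
  [/\ bijective f, bijective g,
      forall x l, inc (f x) (g l) = inc x l &
      f @: O = O'].

Definition system_iso (Y Y' : design) (C : system Y) (C' : system Y')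
    (f : dpoint Y -> dpoint Y') (g : block Y -> block Y') : Prop :=
  [/\ bijective f, bijective g,
      forall b, blockset (g b) = f @: blockset b &
      forall p, C' (f p) = [set g @: (S : {set block Y}) | S in C p]].

(* [M (N (X, O))] and [(X, O)] live on different types; they are identified by
   the canonical renaming p |-> p, b_x |-> x, S_(p, l) |-> l. *)
Definition MN_eq (X : incidence) (O : {set point X}) : Prop :=
  exists (f : point (M_incidence (@N_system X O)) -> point X)
         (g : line (M_incidence (@N_system X O)) -> line X),
    [/\ ovoid_iso (M_ovoid (@N_system X O)) O f g,
        forall p : dpoint (N_design O), f (inl p) = val p,
        forall x : block (N_design O), f (inr x) = val x &
        forall S, val S = N_class O (g S)].

(* Likewise along p |-> p and b |-> b_b, the block of [N] indexed by the
   point b of [M (Y, C)]. *)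
Definition NM_eq (Y : design) (C : system Y) : Prop :=
  exists (f : dpoint Y -> dpoint (N_design (M_ovoid C)))
         (g : block Y -> block (N_design (M_ovoid C))),
    [/\ system_iso C (@N_system _ (M_ovoid C)) f g,
        forall p : dpoint Y, val (f p) = inl p &
        forall b : block Y, val (g b) = inr b].

(* Main.v *)
(* In the direction GQ => design, everything reduces to the absence of
   triangles and the projection of a point on a line: the lines through an
   ovoid point [p] are the parallel classes about [p].

   In the other direction, the only axiom that is not local is the projection
   of a block [b] on a class [S] about a point [q] not in [b].  Each of the [s]
   blocks of [S] shares a parallel class with [t * (s - 1)] other blocks, none
   of which contains [q]; by non-triangularity these sets are disjoint, and
   by cardinality they exhaust the [s * t * (s - 1)] blocks avoiding [q]. *)
Require Import Defs.
From HB Require Import structures.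
From mathcomp Require Import all_boot zify.

Set Implicit Arguments.
Unset Strict Implicit.
Unset Printing Implicit Defensive.

(** * Double counting and finite bijections *)

Lemma double_count (T U : finType) (A : {set T}) (B : {set U})
    (R : T -> U -> bool) (m n : nat) :
  (forall a, a \in A -> #|[set b in B | R a b]| = m) ->
  (forall b, b \in B -> #|[set a in A | R a b]| = n) ->
  #|A| * m = #|B| * n.
Proof.
move=> HA HB; rewrite -!sum_nat_const.
transitivity (\sum_(a in A) \sum_(b in B | R a b) 1).
  by apply: eq_bigr => a /HA <-; rewrite sum1dep_card.
rewrite (exchange_big_dep (mem B)) /=; last by move=> a b _ /andP[].
apply: eq_bigr => b /[dup] bB /HB <-.
by rewrite sum1dep_card; apply: eq_card => a; rewrite !inE bB.
Qed.

Lemma card_eq1 (T : finType) (A : {set T}) (x : T) :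
  x \in A -> (forall y, y \in A -> y = x) -> #|A| = 1.
Proof.
move=> xA Ax; apply/eqP/cards1P; exists x; apply/setP=> y; rewrite inE.
by apply/idP/eqP => [/Ax|->].
Qed.

Lemma inj_surj_bij (T U : finType) (f : T -> U) :
  injective f -> (forall u, exists x, u = f x) -> bijective f.
Proof.
move=> fI fS; apply: (inj_card_bij fI).
rewrite -(card_codom fI); apply/subset_leq_card/subsetP => u _.
by have [x ->] := fS u; exact: codom_f.
Qed.

(** * From a generalized quadrangle with an ovoid to a resolved design *)

Section Quadrangle.

Variables (s t : nat) (X : incidence).
Hypothesis GQ : is_GQ s t X.

Implicit Types (x y z : point X) (k l m : line X).

Lemma GQ_line_uniq x y l m :
  x != y -> inc x l -> inc y l -> inc x m -> inc y m -> l = m.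
Proof.
case: GQ => _ _ [_ H] _ _ xy xl yl xm ym.
by apply/(card_le1_eqP (H x y xy)); rewrite inE ?xl ?xm.
Qed.

Lemma GQ_project x l :
  ~~ inc x l -> exists y m, [/\ inc x m, inc y m & inc y l].
Proof.
by case: GQ => _ _ _ _ H /H [[y m] [/= ?]] _; exists y, m.
Qed.

Lemma GQ_project_uniq x l y m y' m' : ~~ inc x l ->
  inc x m -> inc y m -> inc y l -> inc x m' -> inc y' m' -> inc y' l ->
  y = y' /\ m = m'.
Proof.
case: GQ => _ _ _ _ H /H [z [_ zU]] xm ym yl xm' ym' yl'.
have e : z = (y, m) by apply: zU.
have : z = (y', m') by apply: zU.
by rewrite e => -[].
Qed.

(** The point x is off m, since otherwise k and l would both equal m. Then (y, k) and (z, l) are two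
    projections of x on m, so they agree. *)
Lemma GQ_no_triangle x y z k l m : k != l ->
  inc x k -> inc y k -> inc x l -> inc z l -> inc y m -> inc z m ->
  x != y -> x != z -> y = z.
Proof.
move=> kl xk yk xl zl ym zm xy xz.
have xm : ~~ inc x m.
  apply: contra kl => xm.
  by rewrite (GQ_line_uniq xy xk yk xm ym) (GQ_line_uniq xz xl zl xm zm).
by case: (GQ_project_uniq xm xk yk ym xl zl zm).
Qed.

Variable O : {set point X}.
Hypothesis ovO : is_ovoid O.

Notation OP := (dpoint (N_design O)).
Notation OB := (block (N_design O)).

Lemma ovoid_point l : exists p : OP, inc (val p) l.
Proof.
have /eqP/cards1P [p /setP/(_ p)] := ovO l.
by rewrite !inE eqxx => /andP[pO pl]; exists (exist _ p pO : OP).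
Qed.

Lemma ovoid_uniq l (p q : OP) : inc (val p) l -> inc (val q) l -> p = q.
Proof.
move=> pl ql; apply: val_inj.
have /card_le1_eqP : #|[set x in O | inc x l]| <= 1 by rewrite ovO.
by apply; rewrite inE ?pl ?ql ?(valP p) ?(valP q).
Qed.

Lemma block_neq_point (x : OB) (p : OP) : val x != val p.
Proof. by apply: contraNneq (valP x) => ->; exact: valP p. Qed.

Lemma in_blockset (x : OB) (p : OP) :
  reflect (exists2 l, inc (val x) l & inc (val p) l) (p \in blockset x).
Proof.
rewrite inE; apply: (iffP existsP) => [[l /andP[]]|[l xl pl]]; exists l => //.
by rewrite xl.
Qed.

(** The foot of the projection of q on l lies outside O: the only ovoid point on the projecting line
    is q, and q is off l because l already has p. With [blockset_disjoint], this makes the blocks of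
    l cover each q other than p exactly once. *)
Lemma ovoid_project (p q : OP) l : p != q -> inc (val p) l ->
  exists (x : OB) m, [/\ inc (val x) l, inc (val x) m & inc (val q) m].
Proof.
move=> pq pl.
have ql : ~~ inc (val q) l by apply: contra_neqN pq => /(ovoid_uniq pl).
have [y [m [qm ym yl]]] := GQ_project ql.
have yO : y \notin O.
  apply: contraNN ql => yO.
  by rewrite -[y]/(val (exist _ y yO : OP)) in ym; rewrite (ovoid_uniq qm ym).
by exists (exist _ y yO : OB), m.
Qed.

Lemma blockset_disjoint (p q : OP) l (x y : OB) :
  p != q -> inc (val p) l -> inc (val x) l -> inc (val y) l ->
  q \in blockset x -> q \in blockset y -> x = y.
Proof.
move=> pq pl xl yl /in_blockset[m xm qm] /in_blockset[k yk qk].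
apply: val_inj.
have ql : ~~ inc (val q) l by apply: contra_neqN pq => /(ovoid_uniq pl).
by case: (GQ_project_uniq ql qm xm xl qk yk yl).
Qed.

(** The points of the block correspond one to one to the lines through x, each of which carries
    exactly one ovoid point. The factors 1 let [double_count] compare the two sets without building
    the bijection. *)
Lemma card_blockset (x : OB) : #|blockset x| = 1 + t.
Proof.
case: (GQ) => _ _ [H _] _ _; rewrite -(H (val x)) -[LHS]muln1 -[RHS]muln1.
apply: (@double_count _ _ _ _ (fun (p : OP) l => inc (val p) l)).
  move=> p /in_blockset [l xl pl].
  apply: (@card_eq1 _ _ l) => [|m]; rewrite !inE ?xl // => /andP[xm pm].
  exact: GQ_line_uniq (block_neq_point x p) xm pm xl pl.
move=> l; rewrite inE => xl; have [p pl] := ovoid_point l.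
apply: (@card_eq1 _ _ p) => [|q]; rewrite inE.
  by apply/andP; split=> //; apply/in_blockset; exists l.
by case/andP=> _ ql; exact: ovoid_uniq ql pl.
Qed.

Lemma card_N_class l : #|N_class O l| = s.
Proof.
case: (GQ) => _ _ _ [H _] _.
have := H l; rewrite (cardsD1 (val (xchoose (ovoid_point l)))) inE.
set p := xchoose _; have pl : inc (val p) l := xchooseP (ovoid_point l).
rewrite pl => /(@addnI 1) <-; rewrite -(card_imset _ val_inj).
apply: eq_card => x; rewrite !inE; apply/imsetP/andP => [[y]|[xp xl]].
  by rewrite inE => yl ->; split=> //; exact: block_neq_point.
have xO : x \notin O.
  apply: contraNN xp => xO; apply/eqP.
  by rewrite -(ovoid_uniq (p := exist _ x xO) _ pl).
by exists (exist _ x xO) => //; rewrite inE.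
Qed.

Hypotheses (hs : 1 < s) (ht : 1 < t).

(** Since s > 1, the class of l contains two distinct points off O, and these determine l. *)
Lemma N_class_inj : injective (N_class O).
Proof.
move=> l m e; have : 1 < #|N_class O l| by rewrite card_N_class.
case/card_gt1P => x [y [xl yl xy]].
move: (xl) (yl); rewrite e !inE => xm ym; move: xl yl; rewrite !inE => xl yl.
exact: GQ_line_uniq xl yl xm ym.
Qed.

Lemma N_class_parallel (p : OP) l :
  inc (val p) l -> is_parallel_class p (N_class O l).
Proof.
move=> pl; split.
  move=> x y; rewrite !inE => xl yl e.
  (* As a block has 1 + t points, its trace off p is nonempty; a point q common to two equal traces
     forces x = y. *)
  have : 0 < #|blockset x :\ p|.
    have /eqP := card_blockset x; rewrite (cardsD1 p); case: (_ \in _); lia.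
  case/card_gt0P => q /[dup] qx; rewrite e !inE eq_sym => /andP[pq qy].
  by move: qx; rewrite !inE => /andP[_ qx]; apply: (blockset_disjoint pq pl);
    rewrite // inE.
apply/and3P; split.
- rewrite /cover; apply/eqP/setP => q; rewrite !inE; apply/bigcupP/idP.
    by case=> _ /imsetP[x _ ->]; rewrite !inE => /andP[].
  rewrite eq_sym => pq; have [x [m [xl xm qm]]] := ovoid_project pq pl.
  exists (blockset x :\ p); first by apply: imset_f; rewrite inE.
  by rewrite in_setD1 eq_sym pq; apply/in_blockset; exists m.
- apply/trivIsetP => _ _ /imsetP[x xl ->] /imsetP[y yl ->].
  apply: contraNT => /pred0Pn [q /andP[]]; rewrite /= !in_setD1 eq_sym.
  case/andP=> pq qx /andP[_ qy]; rewrite !inE in xl yl.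
  by rewrite (blockset_disjoint pq pl xl yl qx qy).
- apply/imsetP => -[x _ /setP e].
  have := card_blockset x; rewrite (cardsD1 p).
  rewrite (_ : blockset x :\ p = set0) ?cards0; last exact/setP.
  by case: (_ \in _); lia.
Qed.

Lemma N_systemP : is_local_resolution_system (@N_system X O).
Proof.
move=> p; split; last first.
  by move=> S /imsetP[l]; rewrite inE => /N_class_parallel pl ->.
apply/and3P; split.
- rewrite /cover; apply/eqP/setP => x; rewrite inE.
  apply/bigcupP/in_blockset => [[_ /imsetP[l pl ->]]|[l xl pl]].
    by rewrite !inE in pl * => xl; exists l.
  by exists (N_class O l); rewrite ?inE //; apply: imset_f; rewrite inE.
- apply/trivIsetP => _ _ /imsetP[l pl ->] /imsetP[m pm ->].
  apply: contraNT => /pred0Pn [x /andP[]]; rewrite /= !inE in pl pm * => xl xm.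
  by rewrite (GQ_line_uniq (block_neq_point x p) xl pl xm pm).
- apply/imsetP => -[l _ /esym e].
  by have := card_N_class l; rewrite e cards0; lia.
Qed.

Lemma N_system_commonP (p : OP) (x y : OB) :
  reflect (exists l, [/\ inc (val p) l, inc (val x) l & inc (val y) l])
          (in_common_class (@N_system X O) p x y).
Proof.
apply: (iffP exists_inP) => [[S /imsetP[l pl ->]]|[l [pl xl yl]]].
  by rewrite !inE in pl * => /andP[]; exists l.
by exists (N_class O l); rewrite ?inE ?xl //; apply: imset_f; rewrite inE.
Qed.

(** Three blocks pairwise in common classes are three pairwise collinear points. The lines l and m
    differ because each has a single ovoid point and p differs from q, so a triangle would arise. *)
Lemma N_non_triangular : non_triangular (@N_system X O).
Proof.
move=> x y z xy xz yz p q pq /N_system_commonP[l [pl xl yl]].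
case/N_system_commonP=> m [qm xm zm] r; apply/negP => /N_system_commonP.
case=> k [rk yk zk].
have lm : l != m by apply: contra_neq pq => e; apply: (ovoid_uniq pl);
  rewrite e.
case/eqP: yz; apply: val_inj.
exact: GQ_no_triangle lm xl yl xm zm yk zk _ _.
Qed.

(** The class of a line through p cuts O minus p into s traces of size t. The first line and its
    point p come from the nonemptiness clause of [is_GQ]. *)
Lemma card_ovoid : #|OP| = 1 + s * t.
Proof.
have [[_ /card_gt0P[l _]] _ _ _ _] := GQ; have [p pl] := ovoid_point l.
have [injS pS] := N_class_parallel pl.
have := cardsC1 p; rewrite (@card_uniform_partition _ t _ _ _ pS); last first.
  move=> _ /imsetP[x xl ->]; have := card_blockset x.
  rewrite (cardsD1 p) (_ : p \in _) => [/(@addnI 1)//|].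
  by apply/in_blockset; exists l; rewrite inE in xl.
rewrite card_in_imset // card_N_class => ->.
by rewrite add1n prednK //; apply/card_gt0P; exists p.
Qed.

Lemma N_BIBD : is_BIBD (1 + s * t) (1 + t) (1 + t) (N_design O).
Proof.
split; [nia | exact: card_ovoid | exact: card_blockset |].
move=> A /eqP /cards2P [p [q [pq ->]]].
(* The blocks containing p and q correspond to the 1 + t lines through p: each line carries exactly
   one, the foot of the projection of q. *)
case: (GQ) => _ _ [H _] _ _; rewrite -(H (val p)) -[LHS]muln1 -[RHS]muln1.
apply: (@double_count _ _ _ _ (fun (x : OB) l => inc (val x) l)).
  move=> x; rewrite inE => /subsetP xpq.
  have /in_blockset [l xl pl] : p \in blockset x by apply: xpq; rewrite set21.
  apply: (@card_eq1 _ _ l) => [|m]; rewrite !inE ?xl ?pl // => /andP[pm xm].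
  exact: GQ_line_uniq (block_neq_point x p) xm pm xl pl.
move=> l; rewrite inE => pl; have [x [m [xl xm qm]]] := ovoid_project pq pl.
have px : p \in blockset x by apply/in_blockset; exists l.
have qx : q \in blockset x by apply/in_blockset; exists m.
apply: (@card_eq1 _ _ x) => [|y].
  by rewrite !inE xl andbT; apply/subsetP => r /set2P[]->.
rewrite !inE => /andP[/subsetP ypq yl].
by apply: (blockset_disjoint pq pl yl xl) => //; apply: ypq; rewrite set22.
Qed.

Lemma MN_eqP : MN_eq O.
Proof.
pose f (u : point (M_incidence (@N_system X O))) : point X :=
  match u with inl p => val p | inr x => val x end.
have gE (S : line (M_incidence (@N_system X O))) :
    exists l, val S == N_class O l.
  by case: S => S /= /existsP[p /imsetP[l _ ->]]; exists l.
(* A line of the rebuilt quadrangle is a bare set of blocks, so its original line has to be chosen;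
   [N_class_inj] makes this choice unique. *)
pose g S := xchoose (gE S).
have gP S : val S = N_class O (g S) by apply/eqP/(xchooseP (gE S)).
exists f, g; split=> //; split.
- apply: inj_surj_bij => [[p|x] [q|y] //= e|x].
  + by congr inl; exact: val_inj.
  + by case/eqP: (block_neq_point y p).
  + by case/eqP: (block_neq_point x q).
  + by congr inr; exact: val_inj.
  case: (boolP (x \in O)) => xO; first by exists (inl (exist _ x xO)).
  by exists (inr (exist _ x xO)).
- have h l : [exists p, N_class O l \in @N_system X O p].
    have [p pl] := ovoid_point l.
    by apply/existsP; exists p; apply: imset_f; rewrite inE.
  exists (fun l => exist _ (N_class O l) (h l)).
    by move=> S; apply: val_inj; rewrite /= -gP.
  by move=> l; apply: N_class_inj; rewrite -gP.
- move=> [p|x] S /=; rewrite gP; last by rewrite inE.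
  apply/idP/imsetP => [pS|[l]]; first by exists (g S); rewrite ?inE.
  by rewrite inE => pl /N_class_inj ->.
- apply/setP => x; apply/imsetP/idP => [[_ /imsetP[p _ ->] ->]|xO].
    exact: valP.
  by exists (inl (exist _ x xO)) => //; apply: imset_f.
Qed.

End Quadrangle.

(** * Parallel classes of a resolution system and their sizes *)

Section Design.

Variables (s t : nat) (Y : design) (C : system Y).
Hypotheses (hs : 1 < s) (ht : 1 < t).
Hypothesis BIBD : is_BIBD (1 + s * t) (1 + t) (1 + t) Y.
Hypothesis resC : is_local_resolution_system C.

Implicit Types (p q r : dpoint Y) (b c d : block Y) (S : {set block Y}).

Lemma class_mem p S b : S \in C p -> b \in S -> p \in blockset b.
Proof.
case: (resC p) => /and3P[/eqP/setP /(_ b) e _ _] _ SC bS; move: e.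
by rewrite !inE => <-; apply/bigcupP; exists S.
Qed.

Lemma class_ex p b : p \in blockset b -> exists2 S, S \in C p & b \in S.
Proof.
case: (resC p) => /and3P[/eqP/setP /(_ b) e _ _] _; move: e.
by rewrite !inE => <- /bigcupP[S]; exists S.
Qed.

Lemma class_uniq p S S' b :
  S \in C p -> S' \in C p -> b \in S -> b \in S' -> S = S'.
Proof.
case: (resC p) => /and3P[_ tI _] _ SC S'C bS bS'.
by rewrite -(def_pblock tI SC bS) (def_pblock tI S'C bS').
Qed.

Lemma class_block_ex p S q : S \in C p -> p != q ->
  exists2 b, b \in S & q \in blockset b.
Proof.
case: (resC p) => _ /[apply] -[_ /and3P[/eqP/setP /(_ q) e _ _]] pq; move: e.
rewrite !inE (eq_sym q) pq => /bigcupP[_ /imsetP[b bS ->]].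
by rewrite inE => /andP[_ qb]; exists b.
Qed.

(** Disjointness only makes the traces of b and c off p equal; the injectivity clause of a parallel
    class then identifies the blocks themselves. *)
Lemma class_block_uniq p S q b c : S \in C p -> p != q ->
  b \in S -> c \in S -> q \in blockset b -> q \in blockset c -> b = c.
Proof.
case: (resC p) => _ /[apply] -[injS /and3P[_ tI _]] pq bS cS qb qc.
have blk d : d \in S -> q \in blockset d ->
    pblock [set blockset b :\ p | b in S] q = blockset d :\ p.
  move=> dS qd; apply: def_pblock => //; first exact: imset_f.
  by rewrite !inE eq_sym pq.
by apply: injS => //; rewrite -(blk b) // (blk c).
Qed.

Lemma class_meet p S b c q : S \in C p -> b \in S -> c \in S -> b != c ->
  q \in blockset b -> q \in blockset c -> p = q.
Proof.
move=> SC bS cS bc qb qc; apply: contra_neq_eq bc => pq.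
exact: class_block_uniq SC pq bS cS qb qc.
Qed.

Lemma card_blockD1 p b : p \in blockset b -> #|blockset b :\ p| = t.
Proof.
case: BIBD => _ _ /(_ b) + _; rewrite (cardsD1 p) => + pb.
by rewrite pb => /(@addnI 1).
Qed.

Lemma card_pointsD1 p : #|[set~ p]| = s * t.
Proof. by case: BIBD => _ e _ _; rewrite cardsC1 e. Qed.

Lemma other_point p : exists q, p != q.
Proof.
have /card_gt0P[q] : 0 < #|[set~ p]| by rewrite card_pointsD1; nia.
by rewrite !inE eq_sym; exists q.
Qed.

Lemma card_class p S : S \in C p -> #|S| = s.
Proof.
(* Count pairs (q, b) with q other than p and q in b: each q is in one block of S, and each block
   has t such points. *)
move=> SC; apply/eqP; rewrite -(@eqn_pmul2r t) ?(ltnW ht) //.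
rewrite -(card_pointsD1 p) -[X in _ == X]muln1 eq_sym; apply/eqP.
apply: (@double_count _ _ _ _ (fun q b => q \in blockset b)).
  move=> q; rewrite !inE eq_sym => pq; have [b bS qb] := class_block_ex SC pq.
  apply: (@card_eq1 _ _ b) => [|c]; rewrite !inE ?bS // => /andP[cS qc].
  exact: class_block_uniq SC pq cS bS qc qb.
move=> b bS; rewrite -(card_blockD1 (class_mem SC bS)).
by apply: eq_card => q; rewrite !inE.
Qed.

Lemma class_neq p S b : S \in C p -> exists2 c, c \in S & b != c.
Proof.
move=> SC; have /card_gt0P[c] : 0 < #|S :\ b|.
  by have := card_class SC; rewrite (cardsD1 b); case: (_ \in _); lia.
by rewrite !inE eq_sym => /andP[bc cS]; exists c.
Qed.

Lemma class_gt0 p S : S \in C p -> exists b, b \in S.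
Proof. by move=> /card_class cS; apply/card_gt0P; lia. Qed.

(** Since s > 1, S has two distinct blocks; they meet only in p, yet both contain q. So a set of
    blocks taken as a line determines its centre. *)
Lemma class_point_uniq p q S : S \in C p -> S \in C q -> p = q.
Proof.
move=> pS qS; have [b bS] := class_gt0 pS; have [c cS bc] := class_neq b pS.
exact: class_meet pS bS cS bc (class_mem qS bS) (class_mem qS cS).
Qed.

(** For any q other than p, each class about p has exactly one block through q, so the classes
    correspond to the 1 + t blocks containing p and q. *)
Lemma card_resolution p : #|C p| = 1 + t.
Proof.
have [q pq] := other_point p.
case: BIBD => _ _ _ /(_ [set p; q]) <-; last by rewrite cards2 pq.
rewrite -[LHS]muln1 -[RHS]muln1.
apply: (@double_count _ _ _ _ (fun (S : {set block Y}) b => b \in S)).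
  move=> S SC; have [b bS qb] := class_block_ex SC pq.
  apply: (@card_eq1 _ _ b) => [|c].
    rewrite !inE bS andbT; apply/subsetP => r /set2P[]-> //.
    exact: class_mem SC bS.
  rewrite !inE => /andP[/subsetP pqc cS].
  by apply: (class_block_uniq SC pq cS bS _ qb); apply: pqc; rewrite set22.
move=> b; rewrite !inE => /subsetP pqb.
have [|S SC bS] := @class_ex p b; first by apply: pqb; rewrite set21.
apply: (@card_eq1 _ _ S) => [|S']; rewrite !inE ?SC // => /andP[S'C bS'].
exact: class_uniq S'C SC bS' bS.
Qed.

(** * Counting blocks, and projecting a block on a class *)

Lemma card_blocks_through p : #|[set b | p \in blockset b]| = s * (1 + t).
Proof.
rewrite -(card_resolution p) mulnC; case: (resC p) => pC _.
by apply: card_uniform_partition pC => S; exact: card_class.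
Qed.

Lemma card_blocks : #|block Y| = (1 + s * t) * s.
Proof.
case: BIBD => _ e k _; apply/eqP; rewrite -(@eqn_pmul2r (1 + t)) // -mulnA -e.
rewrite eq_sym -!cardsT; apply/eqP.
apply: (@double_count _ _ _ _ (fun p b => p \in blockset b)).
  by move=> p _; rewrite -(card_blocks_through p); apply: eq_card => b;
    rewrite !inE.
by move=> b _; rewrite -(k b); apply: eq_card => p; rewrite !inE.
Qed.

Lemma card_blocks_avoiding p :
  #|[set b | p \notin blockset b]| = s * (t * s.-1).
Proof.
(* The arithmetic is (1 + s t) s - s (1 + t) = s t (s - 1). *)
have := cardsC [set b | p \in blockset b].
rewrite card_blocks_through card_blocks.
rewrite (_ : ~: _ = [set b | p \notin blockset b]).
  by case: s hs => // s' _; rewrite /=; nia.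
by apply/setP => b; rewrite !inE.
Qed.

Lemma in_common_classP p b c :
  reflect (exists S, [/\ S \in C p, b \in S & c \in S])
          (in_common_class C p b c).
Proof.
apply: (iffP exists_inP) => [[S SC /andP[]]|[S [SC bS cS]]]; exists S => //.
by rewrite bS.
Qed.

(** This is collinearity of distinct block points of [M_incidence C], stated before its lines are
    handled. *)
Definition block_collinear b c : bool :=
  (b != c) && [exists r, in_common_class C r b c].

(** Each of the t points r of b other than p contributes the s - 1 other blocks of the class of b
    about r. They avoid p because they meet b only in r, and for the same reason c determines r. *)
Lemma card_block_collinear p b : p \in blockset b ->
  #|[set c in [set c | p \notin blockset c] | block_collinear b c]|
    = t * s.-1.
Proof.
move=> pb; rewrite -(card_blockD1 pb) -[LHS]muln1.
apply: (@double_count _ _ _ _ (fun c r => in_common_class C r b c)).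
  move=> c; rewrite !inE => /and3P[pc bc /existsP[r]].
  case/in_common_classP=> S [SC bS cS].
  apply: (@card_eq1 _ _ r) => [|q].
    rewrite !inE (class_mem SC bS) andbT; apply/andP; split.
      by apply: contraNneq pc => <-; exact: class_mem SC cS.
    by apply/in_common_classP; exists S.
  rewrite !inE => /andP[_ /in_common_classP[S' [S'C bS' cS']]].
  exact: class_meet S'C bS' cS' bc (class_mem SC bS) (class_mem SC cS).
move=> r; rewrite !inE => /andP[rp rb]; have [S SC bS] := class_ex rb.
have <- : #|S :\ b| = s.-1 by rewrite -(card_class SC) [in RHS](cardsD1 b) bS.
apply: eq_card => c; rewrite !inE; apply/idP/idP.
  case/andP=> /and3P[_ bc _] /in_common_classP[S' [S'C bS' cS']].
  by rewrite eq_sym bc (class_uniq SC S'C bS bS').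
case/andP; rewrite eq_sym => bc cS.
have rbc : in_common_class C r b c by apply/in_common_classP; exists S.
rewrite rbc /block_collinear bc andbT /=; apply/andP; split.
  by apply: contra_neqN rp => pc; exact: class_meet SC bS cS bc pb pc.
by apply/existsP; exists r.
Qed.

Hypothesis ntC : non_triangular C.

(** If b and c were distinct, then b, c, d would violate non-triangularity; the centres p and q
    differ because d contains q but not p. *)
Lemma block_collinear_uniq p S b c d : S \in C p -> b \in S -> c \in S ->
  p \notin blockset d -> block_collinear b d -> block_collinear c d -> b = c.
Proof.
move=> SC bS cS pd /andP[bd /existsP[q bqd]] /andP[cd /existsP[r crd]].
apply: contraTeq crd => bc.
apply: (ntC bc bd cd (p := p) (q := q)) => //.
  case/in_common_classP: bqd => S' [S'C _ dS'].
  by apply: contraNneq pd => ->; exact: class_mem S'C dS'.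
by apply/in_common_classP; exists S.
Qed.

Lemma block_collinear_ex p S d : S \in C p -> p \notin blockset d ->
  exists2 b, b \in S & block_collinear b d.
Proof.
move=> SC pd; set A := [set d | p \notin blockset d].
pose n c := #|[set b in S | block_collinear b c]|.
have n1 c : c \in A -> n c <= 1.
  rewrite inE => pc; apply/card_le1_eqP => b b'; rewrite !inE.
  move=> /andP[b'S b'c] /andP[bS bc].
  exact: block_collinear_uniq SC bS b'S pc bc b'c.
(* Exchanging the sums gives s terms equal to t (s - 1), which add up to the size of A. *)
have sn : \sum_(c in A) n c = \sum_(c in A) 1.
  rewrite sum1_card card_blocks_avoiding -{1}(card_class SC) -sum_nat_const.
  under eq_bigr do rewrite /n -sum1dep_card.
  rewrite (exchange_big_dep (mem S)) /=; last by move=> ? ? _ /andP[].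
  apply: eq_bigr => b bS.
  rewrite -(card_block_collinear (class_mem SC bS)) -sum1dep_card.
  by apply: eq_bigl => c; rewrite bS.
(* Each n c is at most 1 and the totals agree, so the equality case of [leqif_sum] forces n c = 1 on
   all of A. *)
have /forall_inP/(_ d) : [forall (c | c \in A), n c == 1].
  have [_ <-] := leqif_sum (fun c cA => leqif_eq (n1 c cA)).
  exact/eqP.
rewrite inE => /(_ pd)/eqP nd.
have /card_gt0P[b] : 0 < n d by rewrite nd.
by rewrite inE => /andP[]; exists b.
Qed.


(** * The quadrangle built from a resolution system *)

Lemma M_line_in p S : S \in C p -> [exists p, S \in C p].
Proof. by move=> SC; apply/existsP; exists p. Qed.

Definition M_line p S (SC : S \in C p) : line (M_incidence C) :=
  exist _ S (M_line_in SC).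

Lemma M_lineP (l : line (M_incidence C)) : exists p, val l \in C p.
Proof. exact/existsP/(valP l). Qed.

Lemma M_line_uniq (u v : point (M_incidence C)) (l m : line (M_incidence C)) :
  u != v -> inc u l -> inc v l -> inc u m -> inc v m -> l = m.
Proof.
case: u v => [p|b] [q|c] /= uv;
  rewrite ?(inj_eq inl_inj) ?(inj_eq inr_inj) in uv.
- by move=> pl ql; case/eqP: uv; exact: class_point_uniq pl ql.
- by move=> pl cl pm cm; apply: val_inj; exact: class_uniq pl pm cl cm.
- by move=> bl ql bm qm; apply: val_inj; exact: class_uniq ql qm bl bm.
(* Two distinct blocks on a line meet only in its centre, so l and m have the same centre and share
   b. *)
have bc : b != c by apply: contra_neq uv => ->.
have [p pl] := M_lineP l; have [q qm] := M_lineP m.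
move=> bl cl bm cm; apply: val_inj.
have pq := class_meet pl bl cl bc (class_mem qm bm) (class_mem qm cm).
by rewrite -pq in qm; exact: class_uniq pl qm bl bm.
Qed.

Lemma M_card_lines (u : point (M_incidence C)) : #|[set l | inc u l]| = 1 + t.
Proof.
rewrite -(card_imset _ val_inj); case: u => [p|b].
  rewrite -(card_resolution p); apply: eq_card => S.
  apply/imsetP/idP => [[l]|SC]; first by rewrite inE => ? ->.
  by exists (M_line SC); rewrite ?inE.
(* The lines through b correspond to the points of b: the centre of such a line is in b, and each
   point of b has one class containing b. *)
case: BIBD => _ _ /(_ b) <- _; rewrite -[LHS]muln1 -[RHS]muln1.
apply: (@double_count _ _ _ _ (fun (S : {set block Y}) p => S \in C p)).
  move=> _ /imsetP[l bl ->]; have [p pl] := M_lineP l; rewrite inE in bl.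
  apply: (@card_eq1 _ _ p) => [|q]; rewrite !inE.
    by rewrite (class_mem pl bl).
  by case/andP=> _ ql; exact: class_point_uniq ql pl.
move=> p pb; have [S SC bS] := class_ex pb.
apply: (@card_eq1 _ _ S) => [|S']; rewrite !inE.
  by rewrite SC andbT; apply/imsetP; exists (M_line SC); rewrite ?inE.
case/andP=> /imsetP[l bl ->] pl; rewrite inE in bl.
exact: class_uniq pl SC bl bS.
Qed.

Lemma M_card_points (l : line (M_incidence C)) : #|[set u | inc u l]| = 1 + s.
Proof.
have [p pl] := M_lineP l.
rewrite (cardsD1 (inl p)) inE /= pl -(card_class pl); congr (_ + _).
rewrite -(card_imset _ (@inr_inj (dpoint Y) (block Y))).
apply: eq_card => -[q|b]; rewrite !inE /=.
  apply/andP/imsetP => [[qp ql]|[]//].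
  by rewrite (class_point_uniq ql pl) eqxx in qp.
by rewrite (mem_imset _ _ inr_inj).
Qed.

Lemma M_project (u : point (M_incidence C)) (L : line (M_incidence C)) :
  ~~ inc u L -> exists v m, [/\ inc u m, inc v m & inc v L].
Proof.
have [q qL] := M_lineP L; case: u => [p|b] /= uL.
  have qp : q != p by apply: contraNneq uL => <-.
  have [b bL pb] := class_block_ex qL qp; have [S SC bS] := class_ex pb.
  by exists (inr b), (M_line SC).
(* If b contains the centre q of L, then q is the foot; otherwise the counting argument supplies a
   block of L. *)
case: (boolP (q \in blockset b)) => [qb|qb].
  by have [S SC bS] := class_ex qb; exists (inl q), (M_line SC).
have [c cL /andP[_ /existsP[r /in_common_classP[S [SC cS bS]]]]] :=
  block_collinear_ex qL qb.
by exists (inr c), (M_line SC).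
Qed.

Lemma M_project_uniq (u v w : point (M_incidence C))
    (L m k : line (M_incidence C)) : ~~ inc u L ->
  inc u m -> inc v m -> inc v L -> inc u k -> inc w k -> inc w L ->
  v = w /\ m = k.
Proof.
move=> uL um vm vL uk wk wL; suff vw : v = w.
  split=> //; rewrite -vw in wk.
  by apply: (M_line_uniq _ um vm uk wk); apply: contraNneq uL => ->.
have [q qL] := M_lineP L.
(* If b contained q, then b and c would meet in q, so the line l joining them would be centred at q;
   sharing c with L, it would equal L. *)
have qNb b c : b \notin val L -> forall l : line (M_incidence C),
    b \in val l -> c \in val l -> c \in val L -> q \notin blockset b.
  move=> bL l bl cl cL; have bc : b != c by apply: contraNneq bL => ->.
  have [r rl] := M_lineP l; apply: contraNN bL => qb.
  have rq := class_meet rl bl cl bc qb (class_mem qL cL); rewrite rq in rl.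
  by rewrite (class_uniq qL rl cL cl).
case: u v w uL um vm vL uk wk wL => [p|b] [q'|c] [r|d] /= uL um vm vL uk wk wL.
- by congr inl; exact: class_point_uniq vL wL.
- by rewrite (class_point_uniq um vm) vL in uL.
- by rewrite (class_point_uniq uk wk) wL in uL.
- have qp : q != p by apply: contraNneq uL => <-.
  congr inr; apply: (class_block_uniq qL qp vL wL).
    exact: class_mem um vm.
  exact: class_mem uk wk.
- by congr inl; exact: class_point_uniq vL wL.
(* One foot is the centre q, which puts q in b; the other is a block, so [qNb] puts q outside b. The
   next case is symmetric. *)
- have := qNb _ _ uL _ uk wk wL.
  by rewrite -(class_point_uniq vL qL) (class_mem vm um).
- have := qNb _ _ uL _ um vm vL.
  by rewrite -(class_point_uniq wL qL) (class_mem wk uk).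
(* In the remaining case a block has two block feet on L; this is where non-triangularity enters. *)
have bcol (e : block Y) (l : line (M_incidence C)) :
    b \in val l -> e \in val l -> e \in val L -> block_collinear e b.
  move=> bl el eL; apply/andP; split; first by apply: contraNneq uL => <-.
  have [r rl] := M_lineP l; apply/existsP; exists r; apply/in_common_classP.
  by exists (val l).
have qb := qNb _ _ uL _ um vm vL.
congr inr; apply: (block_collinear_uniq qL vL wL qb).
  exact: bcol um vm vL.
exact: bcol uk wk wL.
Qed.

Lemma M_GQ : is_GQ s t (M_incidence C).
Proof.
have [_ eY _ _] := BIBD.
have /card_gt0P[p _] : 0 < #|dpoint Y| by rewrite eY.
have /card_gt0P[S SC] : 0 < #|C p| by rewrite card_resolution.
split.
- by split; apply/card_gt0P; [exists (inl p) | exists (M_line SC)].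
- by split; exact: ltnW.
- split=> [|u v uv]; first exact: M_card_lines.
  apply/card_le1_eqP => l m; rewrite !inE => /andP[ul vl] /andP[um vm].
  exact: M_line_uniq uv um vm ul vl.
- split=> [|l m lm]; first exact: M_card_points.
  apply/card_le1_eqP => u v; rewrite !inE => /andP[ul um] /andP[vl vm].
  by apply: contra_neq_eq lm => vu; apply: M_line_uniq vu _ _ _ _.
move=> u L uL; have [v [m [um vm vL]]] := M_project uL.
exists (v, m); split=> // -[w k] [/= uk wk wL].
by have [-> ->] := M_project_uniq uL um vm vL uk wk wL.
Qed.

Lemma M_ovoidP : is_ovoid (M_ovoid C).
Proof.
move=> l; have [p pl] := M_lineP l.
apply: (@card_eq1 _ _ (inl p)) => [|u]; rewrite !inE.
  by rewrite /= pl andbT; apply: imset_f.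
by case/andP=> /imsetP[q _ ->] /= ql; rewrite (class_point_uniq ql pl).
Qed.

Lemma NM_eqP : NM_eq C.
Proof.
have hf p : inl p \in M_ovoid C by apply: imset_f.
have hg b : inr b \notin M_ovoid C by apply/imsetP => -[].
pose f p : dpoint (N_design (M_ovoid C)) := exist _ (inl p) (hf p).
pose g b : block (N_design (M_ovoid C)) := exist _ (inr b) (hg b).
have fI : injective f by move=> p q [].
have gI : injective g by move=> b c [].
have fE (p' : dpoint (N_design (M_ovoid C))) : exists p, p' = f p.
  by case: p' => u uO; case/imsetP: (uO) => p _ e; exists p; apply: val_inj.
have gE (b' : block (N_design (M_ovoid C))) : exists b, b' = g b.
  case: b' => -[p|b] uO; first by case/negP: (uO).
  by exists b; apply: val_inj.
exists f, g; split=> //; split.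
- exact: inj_surj_bij fI fE.
- exact: inj_surj_bij gI gE.
- move=> b; apply/setP => p'; have [p ->] := fE p'.
  rewrite (mem_imset _ _ fI) inE; apply/existsP/idP => [[l /andP[bl pl]]|pb].
    exact: class_mem pl bl.
  have [S SC bS] := class_ex pb.
  by exists (M_line SC); rewrite /= bS SC.
move=> p.
(* A line of the quadrangle is itself a class of [C], so reading off its points outside the ovoid
   returns that class, renamed by [g]. *)
have gS (l : line (M_incidence C)) : N_class (M_ovoid C) l = g @: val l.
  apply/setP => b'; have [b ->] := gE b'.
  by rewrite (mem_imset _ _ gI) inE.
apply/setP => S'; apply/imsetP/imsetP => [[l]|[S SC ->]].
  by rewrite inE => pl ->; exists (val l).
by exists (M_line SC); [rewrite inE | rewrite gS].
Qed.

End Design.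

Theorem theorem2p1 (s t : nat) (hs : 1 < s) (ht : 1 < t) :
  [/\ (forall (X : incidence) (O : {set point X}),
         is_GQ s t X -> is_ovoid O ->
         [/\ is_BIBD (1 + s * t) (1 + t) (1 + t) (N_design O),
             locally_resolvable (N_design O),
             is_local_resolution_system (@N_system X O) &
             non_triangular (@N_system X O)]),
      (forall (Y : design) (C : system Y),
         is_BIBD (1 + s * t) (1 + t) (1 + t) Y -> locally_resolvable Y ->
         is_local_resolution_system C -> non_triangular C ->
         is_GQ s t (M_incidence C) /\ is_ovoid (M_ovoid C)),
      (forall (X : incidence) (O : {set point X}),
         is_GQ s t X -> is_ovoid O -> MN_eq O) &
      (forall (Y : design) (C : system Y),
         is_BIBD (1 + s * t) (1 + t) (1 + t) Y -> locally_resolvable Y ->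
         is_local_resolution_system C -> non_triangular C ->
         NM_eq C)].
Proof.
split.
- move=> X O GQ ovO; have resO := N_systemP GQ ovO hs ht.
  split=> //; first exact: (N_BIBD GQ ovO hs ht).
    by move=> p; exists (@N_system X O p).
  exact: (N_non_triangular GQ ovO).
- move=> Y C BIBD _ resC ntC; split; first exact: M_GQ.
  exact: (M_ovoidP hs ht BIBD resC).
- by move=> X O GQ ovO; exact: (MN_eqP GQ ovO hs).
- by move=> Y C BIBD _ resC _; exact: NM_eqP.
Qed.
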